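(* Let $A$ be a semiring and $C$ a congruence on $A$. Let $S_C$ be the poset (under inclusion) of all subcongruences of $C$, and let $c:S_C\to S_C$, $D\mapsto D^c$, be a closure operation of finite type. Then the set $$X:=\{D\in S_C\mid D^c=D\},$$ with the hull-kernel topology induced from $2^{A\times A}$, is a spectral space.
   Context: A semiring is a nonempty set $A$ with operations $+,\cdot$ such that $(A,+)$ and $(A,\cdot)$ are commutative monoids (with identities $0$ and $1$), $(a+b)c=ac+bc$ and $0\cdot a=0$. A congruence on $A$ is an equivalence relation $C\subseteq A\times A$ compatible with $+$ and $\cdot$ (i.e. a subsemiring of $A\times A$ that is an equivalence relation). A subcongruence of $C$ is a congruence on $A$ contained in $C$. A congruence is finitely generated if it is the smallest congruence containing some finite subset of $A\times A$. A closure operation on a poset $P$ is a map $\mathrm{cl}:P\to P$ with $x\le\mathrm{cl}(x)$, $\mathrm{cl}(\mathrm{cl}(x))=\mathrm{cl}(x)$, and $x\le y\Rightarrow\mathrm{cl}(x)\le\mathrm{cl}(y)$. A closure operation $c$ on $S_C$ is of finite type if $D^c=\bigcup\{E^c\mid E\subseteq D,\ E\in S_C,\ E\text{ finitely generated}\}$ for all $D\in S_C$. The hull-kernel topology on $2^{A\times A}$ has as open sub-basis the sets $D(F)=\{I\in2^{A\times A}\mid F\not\subseteq I\}$, $F\subseteq A\times A$ finite. A spectral space is a quasi-compact $T_0$ topological space in which finite intersections of quasi-compact open subsets are quasi-compact open, the quasi-compact open subsets form a basis, and every nonempty irreducible closed subset has a unique generic point. *)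

(* Defs.v *)
From HB Require Import structures.
From mathcomp Require Import all_boot all_order all_algebra.
From mathcomp Require Import all_classical topology measurable_structure.

Set Implicit Arguments.
Unset Strict Implicit.
Unset Printing Implicit Defensive.

Import Order.TTheory GRing.Theory.

Local Open Scope classical_set_scope.
Local Open Scope ring_scope.

Record closure_operation d (P : porderType d) (cl : P -> P) : Prop := {
  closure_op_ge : forall x, (x <= cl x)%O ;
  closure_op_idem : forall x, cl (cl x) = cl x ;
  closure_op_homo : forall x y, (x <= y)%O -> (cl x <= cl y)%O
}.

Definition irreducible (T : topologicalType) (Z : set T) : Prop :=
  Z !=set0 /\
  forall F G : set T, closed F -> closed G -> Z `<=` F `|` G ->
    Z `<=` F \/ Z `<=` G.

Definition generic_point (T : topologicalType) (Z : set T) (x : T) : Prop :=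
  closure [set x] = Z.

Definition qc_open (T : topologicalType) : set (set T) :=
  [set U | open U /\ compact U].

(* The library's [compact] is the filter formulation of the covering property
   and does not include separation, i.e. it is quasi-compactness. *)
Record spectral_space (T : topologicalType) : Prop := {
  spectral_compact : compact [set: T] ;
  spectral_T0 : kolmogorov_space T ;
  spectral_bigcap : fin_bigcap_closed (@qc_open T) ;
  spectral_basis : basis (@qc_open T) ;
  spectral_sober : forall Z : set T, closed Z -> irreducible Z ->
    exists! x, generic_point Z x
}.

(* The powerset 2^T with the topology generated by the sub-basis
   D(F) = {I | F not included in I}, F finite. The alias keeps this topology
   apart from any other structure on [set T]. *)
Definition hull_kernel (T : Type) : Type := set T.

HB.instance Definition _ (T : Type) := Choice.on (hull_kernel T).
HB.instance Definition _ (T : Type) :=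
  isSubBaseTopological.Build (hull_kernel T)
    (@finite_set T) (fun F => [set I : hull_kernel T | ~ F `<=` (I : set T)]).

Section congruences.
Variable A : comPzSemiRingType.

Record congruence (C : set (A * A)) : Prop := {
  congruence_equiv : RelationClasses.Equivalence (fun a b => C (a, b)) ;
  congruenceD : forall a b a' b',
    C (a, b) -> C (a', b') -> C (a + a', b + b') ;
  congruenceM : forall a b a' b',
    C (a, b) -> C (a', b') -> C (a * a', b * b')
}.

Definition finitely_generated (E : set (A * A)) : Prop :=
  exists2 F : set (A * A), finite_set F & E = smallest congruence F.

Definition subcongruence (C : set (A * A)) : Type :=
  set_type [set D : set (A * A) | congruence D /\ D `<=` C].

HB.instance Definition _ C := SubChoice.on (subcongruence C).
HB.instance Definition _ C :=
  [SubChoice_isSubPOrder of subcongruence C by <: with set_display].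

Definition finite_type_op C (c : subcongruence C -> subcongruence C) : Prop :=
  forall D : subcongruence C, val (c D) =
    \bigcup_(E in [set E : subcongruence C |
                     (E <= D)%O /\ finitely_generated (val E)]) val (c E).

Definition fixed_subcongruence C
    (c : subcongruence C -> subcongruence C) : Type :=
  set_type [set D : subcongruence C | c D = D].

HB.instance Definition _ C c := SubChoice.on (@fixed_subcongruence C c).

Definition to_hull_kernel C (c : subcongruence C -> subcongruence C)
  (D : fixed_subcongruence c) : hull_kernel (A * A) := val (val D).

End congruences.

(* Main.v *)
(** Every ultrafilter U on the set of fixed subcongruences has a limit for the
    patch (constructible) topology: L = {x | x lies in U-almost every D} is a
    congruence, and it is fixed because a finitely generated E below L is below
    U-almost every D, so that E^c, being contained in D^c = D for U-almost
    every D, is contained in L. Spectrality follows from compactness of the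
    patch topology: the quasi-compact opens are exactly the opens whose
    membership commutes with patch limits, and a generic point of an
    irreducible closed Z is the patch limit of an ultrafilter containing Z and
    all opens meeting Z. *)

Require Import Defs.
From mathcomp Require Import all_boot all_order all_algebra.
From mathcomp Require Import finmap.
From mathcomp Require Import all_classical topology measurable_structure.

Set Implicit Arguments.
Unset Strict Implicit.
Unset Printing Implicit Defensive.

Local Open Scope classical_set_scope.

Lemma setI_fin_bigcap_closed T (G : set (set T)) :
  G setT -> setI_closed G -> fin_bigcap_closed G.
Proof.
(* [Pchoice] gives the index type a choice structure, so that the finite index set becomes an [fset]
   and induction on big operators applies. *)
move=> GT GI I D K; elim/Pchoice: I => I in D K *.
move=> /finite_fsetP[X ->] GK; rewrite bigcap_fset big_seq.
by elim/big_ind: _ => // i; exact: GK.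
Qed.

Lemma filter_subset_of_finite (T E : Type) (U : set_system T)
    (m : T -> set E) (F : set E) : Filter U -> finite_set F ->
  (forall x, F x -> U [set t | m t x]) -> U [set t | F `<=` m t].
Proof.
move=> UF Ffin UFm.
have Ucap : fin_bigcap_closed U.
  by apply: setI_fin_bigcap_closed; [exact: filterT|exact: filterI].
by apply: filterS (Ucap _ F (fun x => [set t | m t x]) Ffin UFm).
Qed.

Section ultrafilter_criterion.
Variables (T : topologicalType) (E : Type) (m : T -> set E).

(** In the application, with [F] finite, these are the finite intersections of the sub-basic sets
    D({x}), which form a basis. *)
Definition avoid (F : set E) : set T := [set t | forall x, F x -> ~ m t x].

(** Convergence in the product topology of 2^E, phrased without constructing the patch topology. *)
Definition patch_limit (U : set_system T) (l : T) : Prop :=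
  forall x, m l x <-> U [set t | m t x].

Definition patch_clopen (K : set T) : Prop :=
  forall (U : set_system T) l, UltraFilter U -> patch_limit U l -> U K <-> K l.

Hypothesis m_inj : injective m.
Hypothesis avoid_open : forall F, finite_set F -> open (avoid F).
Hypothesis avoid_basis : forall (V : set T) t, open V -> V t ->
  exists F, [/\ finite_set F, avoid F t & avoid F `<=` V].
Hypothesis patch_compact : forall U : set_system T,
  UltraFilter U -> exists l, patch_limit U l.

Lemma patch_limit_avoid U l F : UltraFilter U -> patch_limit U l ->
  finite_set F -> avoid F l -> U (avoid F).
Proof.
move=> UU Ul Ffin Fl.
apply: (@filter_subset_of_finite _ _ U (fun t => ~` m t)) => // x Fx.
have [/Ul /(Fl _ Fx)//|//] := in_ultra_setVsetC [set t | m t x] UU.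
Qed.

Lemma patch_limit_cvg U l : UltraFilter U -> patch_limit U l -> U --> l.
Proof.
move=> UU Ul V; rewrite nbhsE => -[W [Wo Wl] WV].
have [F [Ffin Fl FW]] := avoid_basis Wo Wl.
by apply: filterS (patch_limit_avoid UU Ul Ffin Fl); exact: subset_trans FW WV.
Qed.

Lemma patch_clopen_avoid F : finite_set F -> patch_clopen (avoid F).
Proof.
move=> Ffin U l UU Ul; split; last exact: patch_limit_avoid.
move=> UF x Fx /Ul Ux; have [t [Ft]] := filter_ex (filterI UF Ux).
exact: Ft.
Qed.

(** Avoiding a finite set passes to smaller subsets, and such conditions form a basis. *)
Lemma open_le (V : set T) s t : open V -> m s `<=` m t -> V t -> V s.
Proof.
move=> Vo st /(avoid_basis Vo)[F [_ Ft]]; apply => x Fx /st.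
exact: Ft.
Qed.

Lemma qc_openP K : qc_open K <-> open K /\ patch_clopen K.
Proof.
split=> -[Ko Kc]; split=> //; last first.
  rewrite compact_ultra => U UU UK; have [l Ul] := patch_compact UU.
  by exists l; split; [exact/(Kc _ _ UU Ul)|exact: patch_limit_cvg].
move=> U l UU Ul; split=> [UK|Kl]; last first.
  by apply: (patch_limit_cvg UU Ul); exact: open_nbhs_nbhs.
have [k [Kk Uk]] : K `&` [set p | U --> p] !=set0.
  by move: Kc; rewrite compact_ultra; exact.
(* Every topological limit [k] of [U] contains the patch limit: for [x] in [m l] but not in [m k],
   both [avoid [set x]] and its complement would belong to [U]. *)
apply: (open_le Ko _ Kk) => x /Ul Ux; apply: contrapT => kx.
have xo : open (avoid [set x]) by exact/avoid_open/finite_set1.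
have /Uk Uax : nbhs k (avoid [set x]).
  by apply: open_nbhs_nbhs; split=> // _ ->.
by have [t [tx /(_ _ erefl)]] := filter_ex (filterI Ux Uax).
Qed.

Lemma qc_open_avoid F : finite_set F -> qc_open (avoid F).
Proof.
move=> Ffin; apply/qc_openP.
by split; [exact: avoid_open|exact: patch_clopen_avoid].
Qed.

Lemma spectral_of_patch_compact : spectral_space T.
Proof.
have T0 : kolmogorov_space T.
  move=> s t st; wlog [x [sx tx]] : s t st / exists x, m s x /\ ~ m t x.
    move=> IH; have [st'|] := pselect (m s `<=` m t); last first.
      by move=> /existsNP[x /not_implyP ?]; apply: IH => //; exists x.
    have [ts|/existsNP[x /not_implyP tsx]] := pselect (m t `<=` m s).
      by move/eqP: st; case; apply: m_inj; rewrite eqEsubset.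
    have ts : t != s by rewrite eq_sym.
    have [B [?|?]] := IH t s ts (ex_intro _ x tsx); exists B; by [right|left].
  exists (avoid [set x]); right; split; rewrite inE.
    by apply: open_nbhs_nbhs; split; [exact/avoid_open/finite_set1|move=> _ ->].
  by move=> /(_ _ erefl).
split=> //.
- rewrite compact_ultra => U UU _; have [l Ul] := patch_compact UU.
  by exists l; split=> //; exact: patch_limit_cvg.
- apply: setI_fin_bigcap_closed.
    apply/qc_openP; split; first exact: openT.
    by move=> U l UU _; split=> // _; exact: filterT.
  move=> K L /qc_openP[Ko Kp] /qc_openP[Lo Lp]; apply/qc_openP; split.
    exact: openI.
  move=> U l UU Ul; split=> [UKL|[/(Kp _ _ UU Ul) UK /(Lp _ _ UU Ul) UL]].
    split; [apply/(Kp _ _ UU Ul)|apply/(Lp _ _ UU Ul)];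
      by apply: filterS UKL => ? [].
  exact: filterI.
- split=> [K []//|t V]; rewrite nbhsE => -[W [Wo Wt] WV].
  have [F [Ffin Ft FW]] := avoid_basis Wo Wt.
  exists (avoid F); last exact: subset_trans FW WV.
  by split=> //; exact: qc_open_avoid.
move=> Z Zc [[z0 Zz0] Zirr].
pose B := [set V | open V /\ Z `&` V !=set0].
have BF : ProperFilter (filter_from B (fun V => Z `&` V)).
  apply: filter_from_proper; last by move=> V [].
  apply: filter_from_filter.
    by exists setT; split; [exact: openT|exists z0].
  move=> V W [Vo [v [Zv Vv]]] [Wo [w [Zw Ww]]].
  exists (V `&` W); last by move=> t [? [? ?]].
  split; first exact: openI.
  (* If [Z] missed the intersection, the closed complements of [V] and [W] would cover [Z], and
     irreducibility would put [Z] inside one of them. *)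
  apply: contrapT => /set0P/negP/negPn/eqP ZVW0.
  have [] := Zirr (~` V) (~` W) (open_closedC Vo) (open_closedC Wo).
  - move=> t Zt; rewrite -setCI => VWt.
    by have : (Z `&` (V `&` W)) t by []; rewrite ZVW0.
  - by move=> /(_ _ Zv).
  - by move=> /(_ _ Zw).
have [U [UU BU]] := ultraFilterLemma BF.
have [l Ul] := patch_compact UU.
have UV V : open V -> Z `&` V !=set0 -> U (Z `&` V).
  by move=> Vo ZV; apply: BU; exists V.
have UZ : U Z by rewrite -[Z]setIT; apply: UV; [exact: openT|exists z0].
have Zl : Z l.
  rewrite (closure_id Z).1// => V /(patch_limit_cvg UU Ul) UVV.
  exact: filter_ex (filterI UZ UVV).
have lZ : generic_point Z l.
  rewrite /generic_point eqEsubset; split.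
    by rewrite [X in _ `<=` X](closure_id Z).1//; apply: closureS => _ ->.
  (* A basic open [avoid F] around [z] meets [Z], hence belongs to [U], and being patch clopen it
     contains [l]. *)
  move=> z Zz V; rewrite nbhsE => -[W [Wo Wz] WV].
  have [F [Ffin Fz FW]] := avoid_basis Wo Wz.
  exists l; split=> //; apply/WV/FW; apply/(patch_clopen_avoid Ffin UU Ul).
  apply: filterS (UV _ (avoid_open Ffin) _) => [t []//|].
  by exists z.
(* Two generic points of [Z] lie in each other's closure, so no open set separates them and T0 makes
   them equal. *)
exists l; split=> // l' l'Z; apply/eqP; apply: contrapT => /negP.
rewrite -/(l != l') => /T0[V []].
  rewrite !inE => -[Vl Vl'].
  have : closure [set l'] l by rewrite l'Z -lZ; exact: subset_closure.
  by move=> /(_ _ Vl)[_ [->]].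
rewrite !inE => -[Vl' Vl].
have : closure [set l] l' by rewrite lZ -l'Z; exact: subset_closure.
by move=> /(_ _ Vl')[_ [->]].
Qed.

End ultrafilter_criterion.

Lemma hull_kernel_avoid_open (E : Type) (F : set E) : finite_set F ->
  open [set J : hull_kernel E | forall x, F x -> ~ (J : set E) x].
Proof.
move=> Ffin.
have -> : [set J : hull_kernel E | forall x, F x -> ~ (J : set E) x] =
    \bigcap_(x in F) [set J : hull_kernel E | ~ [set x] `<=` (J : set E)].
  rewrite eqEsubset; split=> J FJ x Fx; last first.
    by move=> Jx; apply: (FJ x Fx) => _ ->.
  by move=> /(_ x erefl); exact: FJ.
apply: (setI_fin_bigcap_closed openT openI Ffin) => x _.
set b := fun G : set E => [set J : hull_kernel E | ~ G `<=` (J : set E)].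
exists [set b [set x]]; last by rewrite bigcup_set1.
move=> _ ->; exact: (@finI_from1 _ _ (@finite_set E) b [set x] (finite_set1 x)).
Qed.

(** [V] contains a finite intersection of sets D(G) around [I]. Each such G has a point outside [I],
    so a [J] missing all these points contains no G. *)
Lemma hull_kernel_avoid_basis (E : Type) (V : set (hull_kernel E)) (I : set E) :
  open V -> V I -> exists F : set E,
    [/\ finite_set F, forall x, F x -> ~ I x &
        forall J : set E, (forall x, F x -> ~ J x) -> V J].
Proof.
set b := fun G : set E => [set J : hull_kernel E | ~ G `<=` (J : set E)].
move=> [B Bsub <-] [W BW WI].
have [X Xfin XW] : finI_from (@finite_set E) b W := Bsub _ BW.
have XI : (\bigcap_(G in [set` X]) b G) I by rewrite XW.
(* Deleting all of I from the union of the G keeps it finite and avoids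
   choosing a witness in each G `\` I. *)
exists ((\bigcup_(G in [set` X]) (G : set E)) `\` I); split.
- by apply/finite_setD/bigcup_finite => // G /Xfin; exact: set_mem.
- by move=> x [].
move=> J FJ; suff XJ : (\bigcap_(G in [set` X]) b G) J.
  by exists W; [|rewrite XW in XJ].
move=> G GX GJ; apply: (XI G GX) => x Gx; apply: contrapT => Ix.
by have [] := FJ x (conj (ex_intro2 _ _ G GX Gx) Ix) (GJ x Gx).
Qed.

(** Each congruence axiom has at most two premises, so it holds pointwise on the intersection of at
    most two members of [U]. *)
Lemma ultrafilter_limit_congruence (A : comPzSemiRingType) (T : Type)
    (U : set_system T) (m : T -> set (A * A)) : Filter U ->
  (forall t, congruence (m t)) ->
  congruence [set x | U [set t | m t x]].
Proof.
move=> UF mcong; split=> [|a b a' b' Uab|a b a' b' Uab].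
- split=> [a|a b|a b d].
  + by apply: filterS filterT => t _; have [[r _ _] _ _] := mcong t; exact: r.
  + by apply: filterS => t; have [[_ s _] _ _] := mcong t; exact: s.
  + move=> Uab Ubd; apply: filterS (filterI Uab Ubd) => t [].
    by have [[_ _ tr] _ _] := mcong t; exact: tr.
- by move=> /(filterI Uab); apply: filterS => t []; exact: congruenceD.
- by move=> /(filterI Uab); apply: filterS => t []; exact: congruenceM.
Qed.

Lemma subcongruence_leP (A : comPzSemiRingType) (C : set (A * A)%type)
    (D D' : subcongruence C) : reflect (val D `<=` val D') (D <= D')%O.
Proof. exact: subsetPset. Qed.

Lemma fixed_subcongruence_limit (A : comPzSemiRingType) (C : set (A * A)%type)
    (c : subcongruence C -> subcongruence C)
    (U : set_system (fixed_subcongruence c)) :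
  closure_operation c -> finite_type_op c -> ProperFilter U ->
  exists L : fixed_subcongruence c,
    forall x, val (val L) x <-> U [set D | val (val D) x].
Proof.
move=> ccl cfin UF; pose L := [set x | U [set D | val (val D) x]].
have Lcong : congruence L.
  by apply: ultrafilter_limit_congruence => D; have [] := set_mem (valP (val D)).
have LC : L `<=` C.
  move=> x /filter_ex[D]; have [_] := set_mem (valP (val D)); exact.
pose L1 : subcongruence C := exist _ L (mem_set (conj Lcong LC)).
suff cL1 : c L1 = L1 by exists (exist _ L1 (mem_set cL1)).
(* Extensivity of [c] gives one inequality; finite type reduces the other to finitely generated [E]
   below [L1]. *)
apply/eqP; rewrite Order.POrderTheory.eq_le (closure_op_ge ccl) andbT.
apply/subcongruence_leP; rewrite (cfin L1) => x [E [EL [F Ffin EF]] cEx].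
have UFD : U [set D | F `<=` val (val D)].
  apply: filter_subset_of_finite => // y Fy.
  by apply: (subcongruence_leP _ _ EL); rewrite EF; exact: sub_gen_smallest.
apply: filterS UFD => D FD.
have ED : (E <= val D)%O.
  apply/subcongruence_leP; rewrite EF; apply: smallest_sub => //.
  by have [] := set_mem (valP (val D)).
have /subcongruence_leP := closure_op_homo ccl ED.
by rewrite (set_mem (valP D)); exact.
Qed.

Theorem proposition3p48 (A : comPzSemiRingType) (C : set (A * A)%type)
    (c : subcongruence C -> subcongruence C) :
  congruence C ->
  closure_operation c ->
  finite_type_op c ->
  spectral_space (initial_topology (@to_hull_kernel A C c)).
Proof.
move=> _ ccl cfin.
apply: (@spectral_of_patch_compact (initial_topology (@to_hull_kernel A C c))
          _ (fun D => val (val D))).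
- exact: inj_comp val_inj val_inj.
- move=> F Ffin.
  exists [set J : hull_kernel _ | forall x, F x -> ~ (J : set _) x] => //.
  exact: hull_kernel_avoid_open.
(* Opens of the initial topology are preimages of hull-kernel opens, so the basis is pulled back. *)
- move=> _ D [V Vo <-] VD.
  have [F [Ffin FD FV]] := hull_kernel_avoid_basis Vo VD.
  by exists F; split=> // D'; exact: FV.
- by move=> U UU; exact: fixed_subcongruence_limit.
Qed.
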